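(* Let $1<p<\infty$ and $q=p/(p-1)$. Let $A=(a_{nk})$ be an infinite real matrix with $A\in(\ell_p(\widehat F),\ell_1)$, and let $\bar a_{nk}=\sum_{j=k}^{\infty}\frac{f_{j+1}^{2}}{f_kf_{k+1}}a_{nj}$ for $n,k\in\mathbb N$. For $m\in\mathbb N$ put $$\|A\|^{(m)}_{(\ell_p(\widehat F),\ell_1)}=\sup_{N\in\mathcal F_m}\Big(\sum_k\Big|\sum_{n\in N}\bar a_{nk}\Big|^q\Big)^{1/q},$$ where $\mathcal F_m$ is the collection of all nonempty finite subsets $N$ of $\mathbb N$ such that $n>m$ for all $n\in N$. Then $$\lim_{m\to\infty}\|A\|^{(m)}_{(\ell_p(\widehat F),\ell_1)}\le\|L_A\|_\chi\le 4\lim_{m\to\infty}\|A\|^{(m)}_{(\ell_p(\widehat F),\ell_1)},$$ and $L_A$ is compact if and only if $\lim_{m\to\infty}\|A\|^{(m)}_{(\ell_p(\widehat F),\ell_1)}=0$.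
   Context: $\mathbb N=\{0,1,2,\dots\}$; sums $\sum_k$ run over $k\in\mathbb N$. $\omega$ is the space of all real sequences $x=(x_k)_{k\in\mathbb N}$; $\ell_p$ ($1\le p<\infty$) is the usual space of real $p$-summable sequences with its usual norm. Fibonacci numbers: $f_0=f_1=1$, $f_n=f_{n-1}+f_{n-2}$ for $n\ge2$. For $x\in\omega$ the sequence $y=\widehat F x$ is given by $y_0=\frac{f_0}{f_1}x_0=x_0$ and $y_n=\frac{f_n}{f_{n+1}}x_n-\frac{f_{n+1}}{f_n}x_{n-1}$ for $n\ge1$. $\ell_p(\widehat F)=\{x\in\omega:\widehat F x\in\ell_p\}$, a Banach space with norm $\|x\|_{\ell_p(\widehat F)}=\|\widehat Fx\|_{\ell_p}$. For sequence spaces $X,Y$, $(X,Y)$ is the set of infinite real matrices $A=(a_{nk})_{n,k\in\mathbb N}$ such that for every $x\in X$ the series $A_n(x)=\sum_k a_{nk}x_k$ converges for every $n$ and $Ax=(A_n(x))_n\in Y$. For $A\in(X,Y)$, $L_A:X\to Y$ is the linear operator $L_A(x)=Ax$ (bounded for the spaces considered here). For $A\in(\ell_p(\widehat F),\ell_1)$ the series defining $\bar a_{nk}$ converge for all $n,k$. Hausdorff measure of noncompactness: for a bounded subset $Q$ of a metric space $Y$, $\chi(Q)$ is the infimum of all $\varepsilon>0$ such that $Q$ is covered by finitely many balls $B(x_i,r_i)$ with centres $x_i\in Y$ and radii $r_i<\varepsilon$. For a bounded linear operator $L:X\to Y$ between Banach spaces, $\|L\|_\chi=\chi(L(S_X))$,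 where $S_X$ is the unit sphere of $X$ and $\chi$ is taken in $Y$. A linear operator $L:X\to Y$ defined on all of $X$ is compact if $L(Q)$ is totally bounded for every bounded $Q\subset X$. *)

(* Defs.v *)
From mathcomp Require Import all_boot all_order all_algebra finmap.
From mathcomp Require Import all_classical all_reals all_analysis.
Import Order.TTheory GRing.Theory Num.Theory.
Import numFieldNormedType.Exports.

Set Implicit Arguments.
Unset Strict Implicit.
Unset Printing Implicit Defensive.

Local Open Scope classical_set_scope.
Local Open Scope ring_scope.

(* A space of real sequences is given by its carrier in R^nat and its norm;
   the norm is \bar R-valued and is only meaningful on the carrier. *)
Record seq_space (R : realType) := SeqSpace {
  carrier : set (R^nat) ;
  norm : R^nat -> \bar R }.

Section metric_notions.
Context {R : realType}.
Implicit Types (X Y : seq_space R) (Q : set (R^nat)) (L : R^nat -> R^nat).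

Definition space_ball Y (c : R^nat) (r : R) : set (R^nat) :=
  [set y | carrier Y y /\ (norm Y (y - c)%R < r%:E)%E].

Definition space_sphere X : set (R^nat) := [set x | carrier X x /\ norm X x = 1%E].

Definition space_bounded X Q : Prop :=
  Q `<=` carrier X /\ exists M : R, forall x, Q x -> (norm X x <= M%:E)%E.

Definition space_totally_bounded Y Q : Prop :=
  forall e : R, 0 < e ->
    exists (n : nat) (c : 'I_n -> R^nat),
      (forall i, carrier Y (c i)) /\ Q `<=` \bigcup_i space_ball Y (c i) e.

Definition hausdorff_mnc Y Q : \bar R :=
  ereal_inf [set e%:E | e in [set e : R | 0 < e /\
    exists (n : nat) (c : 'I_n -> R^nat) (r : 'I_n -> R),
      [/\ forall i, carrier Y (c i), forall i, r i < e
        & Q `<=` \bigcup_i space_ball Y (c i) (r i)]]].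

Definition operator_mnc X Y L : \bar R :=
  hausdorff_mnc Y (L @` space_sphere X).

Definition compact_operator X Y L : Prop :=
  forall Q, space_bounded X Q -> space_totally_bounded Y (L @` Q).

End metric_notions.

Section matrix_transformations.
Context {R : realType}.
Implicit Types (X Y : seq_space R) (A : nat -> nat -> R) (x : R^nat).

(* If the series diverges for some n, the n-th entry is a junk value;
   [matrix_class] rules this out on X. *)
Definition matrix_op A x : R^nat :=
  fun n => limn (series (fun k => A n k * x k)).

Definition matrix_class X Y A : Prop :=
  forall x, carrier X x ->
    (forall n, cvgn (series (fun k => A n k * x k))) /\ carrier Y (matrix_op A x).

End matrix_transformations.

(* Indexed so that fib 0 = fib 1 = 1. *)
Fixpoint fib (n : nat) : nat :=
  if n is n'.+1 then
    (if n' is n''.+1 then fib n' + fib n'' else 1)%N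
  else 1%N.

Section fibonacci_difference.
Context {R : realType}.

Definition fibF (x : R^nat) : R^nat := fun n =>
  if n is n'.+1 then
    (fib n)%:R / (fib n.+1)%:R * x n - (fib n.+1)%:R / (fib n)%:R * x n'
  else (fib 0)%:R / (fib 1)%:R * x 0.

Definition lp_norm (p : R) (x : R^nat) : \bar R :=
  'N[counting]_p%:E [EFin \o x]%E.

Definition ell (p : R) : seq_space R :=
  SeqSpace [set x | (lp_norm p x < +oo)%E] (lp_norm p).

Definition ell_fib (p : R) : seq_space R :=
  SeqSpace [set x | carrier (ell p) (fibF x)] (lp_norm p \o fibF).

(* The matrix A-bar with A x = A-bar (fibF x): the factor of [A n j] is the
   (j, k) entry of the inverse of the triangular matrix of [fibF]. *)
Definition fib_assoc (A : nat -> nat -> R) (n k : nat) : R :=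
  limn (fun m => \sum_(k <= j < m)
    (fib j.+1)%:R ^+ 2 / ((fib k)%:R * (fib k.+1)%:R) * A n j).

Definition tail_norm (q : R) (A : nat -> nat -> R) (m : nat) : \bar R :=
  ereal_sup [set lp_norm q (fun k => \sum_(n <- N) fib_assoc A n k)
    | N in [set N : {fset nat} |
        N != fset0 /\ forall n, n \in N -> (m < n)%N]].

End fibonacci_difference.

(* Main.v *)
(* The bijection [fibF] identifies [ell_fib p] with l_p, and carries row n of A
   to the functional T_n y = A_n (fib_inv y) on l_p, which acts on finitely
   supported y through the n-th row of A-bar.  The uniform boundedness principle,
   applied first to the partial sums of each row and then to the finite sums of
   rows, shows that the T_n are continuous and that the tail norms are finite;
   by l_p - l_q duality the m-th tail norm is the supremum of the norms of
   sum_(n in N) T_n over finite N beyond m.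
   In l_1 the measure of noncompactness is governed by the tails
   sum_(n > m) |T_n y|.  Each |sum_(n in N) T_n y| is at most such a tail, which
   gives the lower bound; splitting by the sign of T_n y bounds the tail by twice
   the supremum of these sums (even better than the constant 4), which gives the
   upper bound, the finitely many remaining coordinates being covered by a
   grid. *)
Require Import Defs.
From mathcomp Require Import all_boot all_order all_algebra finmap.
From mathcomp Require Import all_classical all_reals all_analysis.
From mathcomp Require Import ring lra.
Import Order.TTheory GRing.Theory Num.Theory.
Import numFieldNormedType.Exports.

Set Implicit Arguments.
Unset Strict Implicit.
Unset Printing Implicit Defensive.

Local Open Scope classical_set_scope.
Local Open Scope ring_scope.

(** * The l_p norm through its finite partial sums *)

Lemma cvg_bigsum (R : realType) (I : Type) (r : seq I) (u : I -> R^nat)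
    (l : I -> R) : (forall i, u i n @[n --> \oo] --> l i) ->
  \sum_(i <- r) u i n @[n --> \oo] --> \sum_(i <- r) l i.
Proof.
move=> ul; elim: r => [|i r IH].
  rewrite big_nil; under eq_fun do rewrite big_nil; exact: cvg_cst.
rewrite big_cons; under eq_fun do rewrite big_cons; exact: cvgD.
Qed.

(** Taking p-th powers reduces a norm bound to bounds on finite sums of reals, the form in which
    most later estimates are made. *)
Lemma lp_normP (R : realType) (p : R) (y : R^nat) (c : R) : 0 < p -> 0 <= c ->
  (lp_norm p y <= c%:E)%E <->
  forall K, \sum_(k < K) `|y k| `^ p <= c `^ p.
Proof.
move=> p0 c0; rewrite /lp_norm Lnorm_counting//.
have s0 k : (0 <= `|(EFin \o y) k| `^ p)%E by exact: poweR_ge0.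
have partE K : (\sum_(0 <= k < K) `|(EFin \o y) k| `^ p)%E =
    (\sum_(k < K) `|y k| `^ p)%:E.
  by rewrite big_mkord -sumEFin.
have S0 : (0 <= \sum_(k <oo) `|(EFin \o y) k| `^ p)%E by exact: nneseries_ge0.
transitivity ((\sum_(k <oo) `|(EFin \o y) k| `^ p)%E <= (c `^ p)%:E)%E.
  split=> h.
    have := gt0_ler_poweR (ltW p0) _ _ h.
    rewrite poweR_EFin -poweRrM mulVf ?gt_eqF// poweRe1//; apply.
      by rewrite in_itv/= leey poweR_ge0.
    by rewrite in_itv/= leey lee_fin c0.
  have p1 : 0 <= p^-1 by rewrite invr_ge0 ltW.
  have := gt0_ler_poweR p1 _ _ h.
  rewrite poweR_EFin -powRrM mulfV ?gt_eqF// powRr1//; apply.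
    by rewrite in_itv/= leey S0.
  by rewrite in_itv/= leey lee_fin powR_ge0.
split=> h.
  by move=> K; rewrite -lee_fin -partE (le_trans _ h)//; exact: nneseries_lim_ge.
apply: lime_le; first exact: is_cvg_nneseries.
by apply: nearW => K; rewrite partE lee_fin.
Qed.

Lemma lp_norm_ge0 (R : realType) (p : R) (y : R^nat) : (0 <= lp_norm p y)%E.
Proof. exact: Lnorm_ge0. Qed.

Lemma lp_bound_ge0 (R : realType) (p : R) (y : R^nat) (c : R) :
  (lp_norm p y <= c%:E)%E -> 0 <= c.
Proof. by move=> h; rewrite -lee_fin (le_trans _ h)// lp_norm_ge0. Qed.

Lemma lp_finP (R : realType) (p : R) (y : R^nat) :
  carrier (ell p) y <-> exists c : R, (lp_norm p y <= c%:E)%E.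
Proof.
split=> [/= yfin|[c h]]; last by rewrite /= (le_lt_trans h)// ltry.
exists (fine (lp_norm p y)); rewrite fineK// ge0_fin_numE//.
exact: lp_norm_ge0.
Qed.

Lemma lp_normD (R : realType) (p : R) (y z : R^nat) (a b : R) : 1 <= p ->
  (lp_norm p y <= a%:E)%E -> (lp_norm p z <= b%:E)%E ->
  (lp_norm p (fun k => y k + z k)%R <= (a + b)%:E)%E.
Proof.
move=> p1 ya zb; rewrite EFinD (le_trans _ (leeD ya zb))//.
exact: (@minkowski_EFin _ _ _ counting y z).
Qed.

Lemma lp_normZ (R : realType) (p : R) (t : R) (y : R^nat) (a : R) : 0 < p ->
  (lp_norm p y <= a%:E)%E ->
  (lp_norm p (fun k => t * y k)%R <= (`|t| * a)%:E)%E.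
Proof.
move=> p0 ya; have a0 := lp_bound_ge0 ya.
move: ya => /(lp_normP _ p0 a0) ya.
apply/lp_normP => //; first by rewrite mulr_ge0.
move=> K; rewrite powRM// (le_trans _ (ler_wpM2l (powR_ge0 _ _) (ya K)))//.
by rewrite mulr_sumr ler_sum// => k _; rewrite normrM powRM.
Qed.

Lemma lp_norm_add_scale (R : realType) (p : R) (t : R) (y z : R^nat) (a b : R) :
  1 <= p -> (lp_norm p y <= a%:E)%E -> (lp_norm p z <= b%:E)%E ->
  (lp_norm p (fun k => y k + t * z k)%R <= (a + `|t| * b)%:E)%E.
Proof.
move=> p1 ya zb; apply: lp_normD => //; apply: lp_normZ => //.
exact: lt_le_trans p1.
Qed.

Lemma lp_norm_coord (R : realType) (p : R) (y : R^nat) (a : R) (k : nat) :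
  0 < p -> (lp_norm p y <= a%:E)%E -> `|y k| <= a.
Proof.
move=> p0 ya; have a0 := lp_bound_ge0 ya.
move: ya => /(lp_normP _ p0 a0)/(_ k.+1).
rewrite big_ord_recr/= => h; rewrite leNgt; apply/negP => ak.
have := gt0_ltr_powR p0 _ _ ak; rewrite !nnegrE normr_ge0 => /(_ a0 isT).
rewrite ltNge => /negP; apply; apply: le_trans h.
by rewrite lerDr sumr_ge0// => i _; exact: powR_ge0.
Qed.

Lemma lp_norm0 (R : realType) (p : R) : 0 < p ->
  (lp_norm p (fun=> 0%R : R) <= 0%:E)%E.
Proof.
move=> p0; apply/lp_normP => // K.
by rewrite big1 ?powR_ge0// => k _; rewrite normr0 powR0 ?gt_eqF.
Qed.

(** * Coordinatewise limits and completeness of l_p *)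

Lemma cvg_powR (R : realType) (p : R) (u : R^nat) (l : R) : 0 < p ->
  (forall n, 0 <= u n) -> u n @[n --> \oo] --> l ->
  u n `^ p @[n --> \oo] --> l `^ p.
Proof.
move=> p0 u0 ul.
have : 0 <= l.
  rewrite -(cvg_lim (@Rhausdorff R) ul); apply: limr_ge.
    by apply/cvg_ex; exists l.
  exact: nearW.
(* At a positive limit the power is differentiable, hence continuous; at 0 the threshold e^(1/p) for
   [u n] gives the claim directly. *)
rewrite le_eqVlt => /predU1P[l0|l0].
  rewrite -l0 in ul *; rewrite powR0 ?gt_eqF//.
  apply/cvgr0Pnorm_lt => e e0.
  have ep : 0 < e `^ p^-1 by exact: powR_gt0.
  move/cvgr0Pnorm_lt : ul => /(_ _ ep); apply: filterS => n.
  rewrite !ger0_norm ?powR_ge0// => une.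
  have := gt0_ltr_powR p0 _ _ une; rewrite !nnegrE u0 powR_ge0 => /(_ isT isT).
  by rewrite -powRrM mulVf ?gt_eqF// powRr1// ltW.
apply: (cvg_comp u (fun x : R => x `^ p) ul).
apply: (@differentiable_continuous _ _ _ l (fun x : R => x `^ p)); apply/derivable1_diffP.
by apply: derivable_powR; rewrite in_itv/= l0.
Qed.

(** As in Fatou's lemma: each partial sum involves finitely many coordinates, so it is continuous
    under coordinatewise convergence and its bound survives in the limit. *)
Lemma lp_norm_closed (R : realType) (p : R) (x : nat -> R^nat) (y z : R^nat)
    (c : R) : 0 < p -> (forall k, x m k @[m --> \oo] --> y k) ->
  (\forall m \near \oo, (lp_norm p (fun k => x m k - z k)%R <= c%:E)%E) ->
  (lp_norm p (fun k => y k - z k)%R <= c%:E)%E.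
Proof.
move=> p0 xy xc.
have c0 : 0 <= c by have [N _ /(_ N (leqnn N)) /lp_bound_ge0] := xc.
apply/lp_normP => // K.
have cvK : \sum_(k < K) `|x m k - z k| `^ p @[m --> \oo] -->
    \sum_(k < K) `|y k - z k| `^ p.
  apply: cvg_bigsum => k.
  apply: cvg_powR => //.
  by apply: cvg_norm; apply: cvgB => //; exact: cvg_cst.
rewrite -(cvg_lim (@Rhausdorff R) cvK).
apply: limr_le; first by apply/cvg_ex; eexists; exact: cvK.
by move: xc; apply: filterS => m /(lp_normP _ p0 c0).
Qed.

(** Completeness in the one case needed below: steps of size 3^-n telescope, and the distance still
    to go after stage n is at most the geometric sum 3/2 * 3^-n. *)
Lemma lp_geometric_limit (R : realType) (p : R) (x : nat -> R^nat) : 1 <= p ->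
  (forall n, (lp_norm p (fun k => x n.+1 k - x n k)%R <= (3^-1 ^+ n)%:E)%E) ->
  exists y : R^nat, forall n,
    (lp_norm p (fun k => y k - x n k)%R <= (3 / 2 * 3^-1 ^+ n)%:E)%E.
Proof.
move=> p1 dx; have p0 : 0 < p by exact: lt_le_trans p1.
have D n j : (lp_norm p (fun k => x (n + j)%N k - x n k)%R <=
              (3 / 2 * 3^-1 ^+ n * (1 - 3^-1 ^+ j))%:E)%E.
  elim: j => [|j IH].
    rewrite addn0 expr0 subrr mulr0.
    have -> : (fun k => x n k - x n k)%R = (fun=> 0) by apply/funext => k; rewrite subrr.
    exact: lp_norm0.
  have -> : (fun k => x (n + j.+1)%N k - x n k)%R =
      (fun k => (x (n + j)%N k - x n k) + (x (n + j).+1 k - x (n + j)%N k))%R.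
    by apply/funext => k; rewrite addnS; ring.
  have -> : 3 / 2 * 3^-1 ^+ n * (1 - 3^-1 ^+ j.+1) =
     3 / 2 * 3^-1 ^+ n * (1 - 3^-1 ^+ j) + 3^-1 ^+ (n + j) :> R.
    by rewrite exprS exprD; field.
  exact: lp_normD.
have D' n m : (n <= m)%N -> (lp_norm p (fun k => x m k - x n k)%R <=
              (3 / 2 * 3^-1 ^+ n)%:E)%E.
  move=> nm; have := D n (m - n)%N; rewrite subnKC// => /le_trans; apply.
  have e0 j : 0 <= 3^-1 ^+ j :> R by rewrite exprn_ge0.
  by rewrite lee_fin ler_piMr// ?mulr_ge0 ?divr_ge0// lerBlDr lerDl.
have small (e : R) : 0 < e -> exists n, 3 / 2 * 3^-1 ^+ n < e.
  move=> e0; have : geometric (3 / 2 : R) 3^-1 @ \oo --> 0.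
    by apply: cvg_geometric; rewrite ger0_norm// invf_lt1// ltr1n.
  move/cvgr0Pnorm_lt => /(_ _ e0)[n _ /(_ n (leqnn n))] /= h.
  by exists n; rewrite (le_lt_trans (ler_norm _)).
have cx k : cvgn (fun m => x m k).
  apply/cauchy_cvgP/cauchy_exP => e e0.
  have [n ne] := small _ e0.
  exists (x n k), n => // m /= nm; rewrite -ball_normE/= distrC.
  exact: le_lt_trans (lp_norm_coord _ p0 (D' _ _ nm)) ne.
exists (fun k => limn (fun m => x m k)) => n.
apply: lp_norm_closed cx _ => //.
by exists n => // m /= nm; exact: D'.
Qed.

(** * The uniform boundedness principle on l_p *)

Section uniform_boundedness.
Context {R : realType} (p : R) (hp : 1 <= p).

Definition lp_linear (T : R^nat -> R) := forall t y z,
  carrier (ell p) y -> carrier (ell p) z ->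
  T (fun k => y k + t * z k) = T y + t * T z.

(* [c] ranges over real upper bounds of the norm, so that no [fine] is needed. *)
Definition lp_bounded_by (T : R^nat -> R) (C : R) := forall y c,
  (lp_norm p y <= c%:E)%E -> `|T y| <= C * c.

Let p_gt0 : 0 < p. Proof. exact: lt_le_trans hp. Qed.

Lemma lp_linear0 T : lp_linear T -> T (fun=> 0) = 0.
Proof.
move=> lT; have z : carrier (ell p) (fun=> 0 : R).
  by apply/lp_finP; exists 0; exact: lp_norm0.
have := lT (-1) _ _ z z; under eq_fun do rewrite mulr0 addr0.
by move=> ->; rewrite mulN1r subrr.
Qed.

Lemma lp_linearZ T t y : lp_linear T -> carrier (ell p) y ->
  T (fun k => t * y k) = t * T y.
Proof.
move=> lT yp; have z : carrier (ell p) (fun=> 0 : R).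
  by apply/lp_finP; exists 0; exact: lp_norm0.
have := lT t _ _ z yp; under eq_fun do rewrite add0r.
by move=> ->; rewrite lp_linear0// add0r.
Qed.

Lemma lp_linear_sum (I : Type) (r : seq I) (T : I -> R^nat -> R) (a : I -> R) :
  (forall i, lp_linear (T i)) ->
  lp_linear (fun y => \sum_(i <- r) a i * T i y).
Proof.
move=> lT t y z yp zp; rewrite mulr_sumr -big_split/=; apply: eq_bigr => i _.
by rewrite lT//; ring.
Qed.

Lemma lp_bounded_sum (I : Type) (r : seq I) (T : I -> R^nat -> R) (a : I -> R) :
  (forall i, exists C, lp_bounded_by (T i) C) ->
  exists C, lp_bounded_by (fun y => \sum_(i <- r) a i * T i y) C.
Proof.
move=> /choice[C bT]; exists (\sum_(i <- r) `|a i| * C i) => y c yc.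
rewrite (le_trans (ler_norm_sum _ _ _))// mulr_suml ler_sum// => i _.
by rewrite normrM -mulrA ler_wpM2l// bT.
Qed.

(** [N] is the operator norm, the supremum over the unit ball; when positive, it is approached there
    within a quarter of itself. *)
Lemma lp_bounded_norming T : lp_linear T -> (exists C, lp_bounded_by T C) ->
  exists2 N, 0 <= N & lp_bounded_by T N /\
    (0 < N -> exists2 z, (lp_norm p z <= 1%:E)%E & 3 / 4 * N <= `|T z|).
Proof.
move=> lT [C bT].
pose S := [set `|T y| | y in [set y | (lp_norm p y <= 1%:E)%E]].
have S0 : S 0.
  exists (fun=> 0); last by rewrite lp_linear0// normr0.
  by rewrite /= (le_trans (lp_norm0 p_gt0))// lee_fin.
have hS : has_sup S.
  split; first by exists 0.
  by exists C => _ [y y1 <-]; rewrite -[C]mulr1 bT.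
have ubS : ubound S (sup S) by exact: sup_upper_bound.
have N0 : 0 <= sup S by exact: ubS.
exists (sup S) => //; split.
  move=> y c yc; have := lp_bound_ge0 yc; rewrite le_eqVlt => /predU1P[c0|c0].
    by have := bT _ _ yc; rewrite -c0 !mulr0.
  have yp : carrier (ell p) y by apply/lp_finP; exists c.
  have := lp_normZ c^-1 p_gt0 yc; rewrite gtr0_norm ?invr_gt0// mulVf ?gt_eqF//.
  move=> h; rewrite -ler_pdivrMr// mulrC -[X in X * _]gtr0_norm ?invr_gt0//.
  by rewrite -normrM -lp_linearZ//; apply: ubS; exists (fun k => c^-1 * y k).
move=> Ngt0; have e0 : 0 < sup S / 4 by rewrite divr_gt0.
have [_ [z z1 <-] Sz] := sup_adherent e0 hS.
by exists z => //; lra.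
Qed.

(* Sokal's argument: the sign in [x n.+1 = x n +- 3^-n z n] can always be chosen
   so that the norming vector [z n] is not cancelled by [x n]. *)
Lemma lp_uniform_boundedness (I : Type) (T : I -> R^nat -> R) :
  (forall i, lp_linear (T i)) ->
  (forall i, exists C, lp_bounded_by (T i) C) ->
  (forall y, carrier (ell p) y -> exists M, forall i, `|T i y| <= M) ->
  exists2 C, 0 <= C & forall i, lp_bounded_by (T i) C.
Proof.
move=> lT bT pT.
have nT i := lp_bounded_norming (lT i) (bT i).
have {nT} /choice[N nT] : forall i, exists N, 0 <= N /\ lp_bounded_by (T i) N /\
    (0 < N -> exists2 z, (lp_norm p z <= 1%:E)%E & 3 / 4 * N <= `|T i z|).
  by move=> i; have [N ? ?] := nT i; exists N.
apply: contrapT => unb.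
(* Without a uniform bound some functional has norm above 4^n, which outgrows the shrinking of the
   steps 3^-n. *)
have big (n : nat) : exists iz : I * R^nat,
    [/\ 4 ^+ n < N iz.1, (lp_norm p iz.2 <= 1%:E)%E &
        3 / 4 * N iz.1 <= `|T iz.1 iz.2|].
  have [i Ni] : exists i, 4 ^+ n < N i.
    apply: contrapT => Nle; apply: unb; exists (4 ^+ n); first exact: exprn_ge0.
    move=> i y c yc; have [N0 [bN _]] := nT i.
    rewrite (le_trans (bN _ _ yc))// ler_wpM2r ?(lp_bound_ge0 yc)//.
    by rewrite leNgt; apply/negP => iN; apply: Nle; exists i.
  have [_ [_ /(_ (le_lt_trans (exprn_ge0 n (ler0n R 4)) Ni))[z z1 Nz]]] := nT i.
  by exists (i, z).
move: big => /choice[iz big].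
pose i n := (iz n).1; pose z n := (iz n).2.
pose step n (v : R^nat) s : R^nat := fun k => v k + s * z n k.
pose t n : R := 3^-1 ^+ n.
have t0 n : 0 < t n by rewrite exprn_gt0.
pose nxt n v := if t n * `|T (i n) (z n)| <= `|T (i n) (step n v (t n))|
  then step n v (t n) else step n v (- t n).
pose fix x n : R^nat := if n is m.+1 then nxt m (x m) else fun=> 0.
have zp n : carrier (ell p) (z n) by apply/lp_finP; exists 1; have [] := big n.
have stepE n v s : carrier (ell p) v ->
    T (i n) (step n v s) = T (i n) v + s * T (i n) (z n).
  by move=> vp; rewrite /step lT.
have nxtp n v : carrier (ell p) v ->
    t n * `|T (i n) (z n)| <= `|T (i n) (nxt n v)|.
  move=> vp; rewrite /nxt; case: ifPn => //; rewrite -ltNge !stepE//.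
  have -> : t n * `|T (i n) (z n)| = `|t n * T (i n) (z n)|.
    by rewrite normrM gtr0_norm.
  (* [a + b] and [a - b] differ by [2 * b], so one of them has modulus at least |b|. *)
  rewrite mulNr; set a := T _ v; set b := t n * _ => h.
  have := ler_normB (a + b) (a - b).
  have -> : a + b - (a - b) = 2 * b by ring.
  by rewrite normrM (@ger0_norm _ 2)//; lra.
have nxtd n v : exists2 s, `|s| = t n & nxt n v = step n v s.
  rewrite /nxt; case: ifPn => _; [exists (t n)|exists (- t n)] => //.
    exact: gtr0_norm.
  by rewrite normrN gtr0_norm.
have zn n : (lp_norm p (z n) <= 1%:E)%E by have [] := big n.
have xp n : carrier (ell p) (x n).
  elim: n => [|n /lp_finP[c xc]] /=.
    by apply/lp_finP; exists 0; exact: lp_norm0.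
  have [s st ->] := nxtd n (x n).
  by apply/lp_finP; eexists; apply: lp_norm_add_scale xc (zn n).
have dx n : (lp_norm p (fun k => x n.+1 k - x n k)%R <= (t n)%:E)%E.
  rewrite /=; have [s st ->] := nxtd n (x n).
  have -> : (fun k => step n (x n) s k - x n k) = (fun k => s * z n k).
    by apply/funext => k; rewrite /step; ring.
  by rewrite (le_trans (lp_normZ _ p_gt0 (zn n)))// st mulr1.
have [y yx] := lp_geometric_limit hp dx.
have yp : carrier (ell p) y.
  apply/lp_finP; have := yx 0%N; rewrite /=.
  have -> : (fun k => y k - 0) = y by apply/funext => k; rewrite subr0.
  by move=> ?; eexists; eassumption.
have [M yM] := pT y yp.
(* The norming vector makes |T (x n.+1)| at least 3/4 t N, and passing from [x n.+1] to the limit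
   [y] loses at most 1/2 t N. What remains, t N / 4, exceeds (4/3)^n / 4. *)
have low n : 4^-1 * (4 / 3) ^+ n <= M.
  apply: le_trans (yM (i n)).
  have [N4 _ Nz] := big n; rewrite -/(i n) -/(z n) in N4 Nz.
  have [_ [/(_ _ _ (yx n.+1)) bN _]] := nT (i n).
  have h := nxtp n _ (xp n).
  have yE : T (i n) (fun k => y k - x n.+1 k) = T (i n) y - T (i n) (x n.+1).
    rewrite -[RHS]/(_ + - _) -mulN1r -lT//; congr (T _ _).
    by apply/funext => k; rewrite mulN1r.
  rewrite yE in bN.
  have h2 := ler_normB (T (i n) y) (T (i n) y - T (i n) (x n.+1)).
  rewrite subKr in h2.
  have h3 : 3 / 2 * 3^-1 ^+ n.+1 = 2^-1 * t n by rewrite exprS /t; field.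
  rewrite h3 in bN.
  have h4 := ler_wpM2l (ltW (t0 n)) Nz.
  have h5 := ler_wpM2l (ltW (t0 n)) (ltW N4).
  have -> : 4^-1 * (4 / 3) ^+ n = 4^-1 * (t n * 4 ^+ n) :> R.
    by rewrite /t exprMn mulrC; ring.
  rewrite -/(x n.+1) in h; lra.
have bern n : n%:R / 3 <= (4 / 3) ^+ n :> R.
  have : 1 + n%:R / 3 <= (4 / 3) ^+ n :> R.
    elim: n => [|n IH]; first by rewrite mul0r addr0 expr0.
    rewrite exprS -natr1.
    have : 0 <= n%:R :> R by exact: ler0n.
    by move: IH; lra.
  lra.
(* For n above 12 M, the chain n / 12 <= (4/3)^n / 4 <= M is contradictory. *)
have := low (Num.bound (12 * M)); have := bern (Num.bound (12 * M)).
have M0 : 0 <= 12 * M by rewrite mulr_ge0// (le_trans _ (yM (i 0%N))).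
have := archi_boundP M0; lra.
Qed.

End uniform_boundedness.

(** * The inverse of the Fibonacci difference matrix *)

Section fibonacci_inverse.
Context {R : realType}.
Implicit Types (x y : R^nat).

Arguments fib : simpl never.

Lemma fib_gt0 n : (0 < fib n)%N.
Proof.
suff : (0 < fib n)%N && (0 < fib n.+1)%N by case/andP.
elim: n => // n /andP[h1 h2]; rewrite h2 andTb.
by rewrite -[fib n.+2]/(fib n.+1 + fib n)%N addn_gt0 h2.
Qed.

Lemma fib_neq0 n : (fib n)%:R != 0 :> R.
Proof. by rewrite pnatr_eq0 -lt0n fib_gt0. Qed.

(** For k <= j, the entry in row j and column k of the inverse matrix; the column comes first. *)
Definition fib_coef (k j : nat) : R :=
  (fib j.+1)%:R ^+ 2 / ((fib k)%:R * (fib k.+1)%:R).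

Definition fib_inv (y : R^nat) : R^nat :=
  fun j => \sum_(k < j.+1) fib_coef k j * y k.

(** Solving [fibF x = y] for entry j + 1 of x gives this recursion; both cancellation laws rest on
    it. *)
Lemma fib_invS y j : fib_inv y j.+1 =
  (fib j.+2)%:R ^+ 2 / (fib j.+1)%:R ^+ 2 * fib_inv y j +
  fib_coef j.+1 j.+1 * y j.+1.
Proof.
rewrite {1}/fib_inv big_ord_recr/=; congr (_ + _).
rewrite mulr_sumr; apply: eq_bigr => k _; rewrite /fib_coef.
by field; rewrite !fib_neq0.
Qed.

Lemma fib_inv0 y : fib_inv y 0 = y 0%N.
Proof. by rewrite /fib_inv big_ord1 /fib_coef -[fib 0]/1%N -[fib 1]/1%N; field. Qed.

Lemma fib_invK : cancel fib_inv fibF.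
Proof.
move=> y; apply/funext => -[|n]; first by rewrite /fibF fib_inv0 -[fib 0]/1%N -[fib 1]/1%N; field.
rewrite /fibF fib_invS /fib_coef.
by field; rewrite !fib_neq0.
Qed.

Lemma fibFK : cancel fibF fib_inv.
Proof.
move=> x; apply/funext; elim=> [|n IH].
  by rewrite fib_inv0 /fibF -[fib 0]/1%N -[fib 1]/1%N; field.
rewrite fib_invS IH /fib_coef [fibF x n.+1]/fibF.
by field; rewrite !fib_neq0.
Qed.

Lemma fib_inv_unit (k j : nat) :
  fib_inv (fun i => (i == k)%:R) j = if (k <= j)%N then fib_coef k j else 0.
Proof.
rewrite /fib_inv; case: leqP => kj.
  have kj' : (k < j.+1)%N by [].
  rewrite (bigD1 (Ordinal kj'))//= eqxx mulr1 big1 ?addr0// => i ik.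
  suff -> : (i == k :> nat) = false by rewrite mulr0.
  by apply/negbTE; apply: contra ik => /eqP ik; apply/eqP/val_inj.
rewrite big1// => i _; suff -> : (i == k :> nat) = false by rewrite mulr0.
by apply/negbTE; rewrite neq_ltn (leq_ltn_trans _ kj) // -ltnS.
Qed.

End fibonacci_inverse.

(** * Truncation, Hoelder's inequality and duality *)

Definition truncate (R : realType) (K : nat) (y : R^nat) : R^nat :=
  fun k => if (k < K)%N then y k else 0.

Lemma lp_norm_truncate (R : realType) (p : R) (y : R^nat) (c : R) (K : nat) :
  0 < p -> (lp_norm p y <= c%:E)%E -> (lp_norm p (truncate K y) <= c%:E)%E.
Proof.
move=> p0 yc; have c0 := lp_bound_ge0 yc.
apply/(lp_normP _ p0 c0) => M.
apply: le_trans (((lp_normP _ p0 c0).1 yc) M).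
apply: ler_sum => k _; rewrite /truncate; case: ifP => // _.
by rewrite normr0 powR0 ?gt_eqF// powR_ge0.
Qed.

(** The partial sums of |y k|^p come within e^p of their supremum at some [K], so any block of terms
    from [K] on sums to less than e^p. *)
Lemma truncate_dense (R : realType) (p : R) (y : R^nat) (e : R) :
  0 < p -> carrier (ell p) y -> 0 < e -> exists K,
  (lp_norm p (fun k => y k - truncate K y k)%R <= e%:E)%E.
Proof.
move=> p0 /lp_finP[c yc] e0; have c0 := lp_bound_ge0 yc.
pose s (K : nat) : R := \sum_(k < K) `|y k| `^ p.
have sb := (lp_normP _ p0 c0).1 yc.
have hs : has_sup (range s).
  by split; [exists (s 0%N), 0%N | exists (c `^ p) => _ [K _ <-]; exact: sb].
have ep : 0 < e `^ p by exact: powR_gt0.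
have [_ [K _ <-] sK] := sup_adherent ep hs.
exists K; apply/(lp_normP _ p0 (ltW e0)) => M.
have -> : \sum_(k < M) `|y k - truncate K y k| `^ p =
    \sum_(k < M | (K <= k)%N) `|y k| `^ p.
  rewrite [RHS]big_mkcond/=; apply: eq_bigr => k _; rewrite /truncate.
  case: leqP => _; first by rewrite subr0.
  by rewrite subrr normr0 powR0 ?gt_eqF.
have : s (maxn K M) <= sup (range s) by apply: sup_upper_bound => //; exists (maxn K M).
rewrite {1}/s (bigID (fun k : 'I__ => (k < K)%N))/=.
have -> : \sum_(k < maxn K M | (k < K)%N) `|y k| `^ p = s K.
  by rewrite -(big_ord_widen_cond _ xpredT (fun k => `|y k| `^ p)) ?leq_maxl.
have : \sum_(k < M | (K <= k)%N) `|y k| `^ p <=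
    \sum_(k < maxn K M | ~~ (k < K)%N) `|y k| `^ p.
  rewrite (big_ord_widen_cond (maxn K M) (fun k => (K <= k)%N)
    (fun k => `|y k| `^ p)) ?leq_maxr//.
  rewrite big_mkcond [leRHS]big_mkcond ler_sum//= => k _.
  by rewrite -leqNgt; case: (K <= k)%N => //=; case: ifP => // _.
lra.
Qed.

Lemma lp_norm1P (R : realType) (y : R^nat) (c : R) : 0 <= c ->
  (lp_norm 1 y <= c%:E)%E <-> forall K, \sum_(k < K) `|y k| <= c.
Proof.
move=> c0; have sumE K : \sum_(k < K) `|y k| `^ 1 = \sum_(k < K) `|y k|.
  by apply: eq_bigr => k _; rewrite powRr1.
split=> [/(lp_normP _ ltr01 c0) h K|h]; first by rewrite -sumE -[c]powRr1.
by apply/(lp_normP _ ltr01 c0) => K; rewrite sumE powRr1.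
Qed.

Lemma hoelder_sum (R : realType) (p q : R) (h y : R^nat) (a c : R) (K : nat) :
  0 < p -> 0 < q -> p^-1 + q^-1 = 1 ->
  (lp_norm q h <= a%:E)%E -> (lp_norm p y <= c%:E)%E ->
  `|\sum_(k < K) h k * y k| <= a * c.
Proof.
move=> p0 q0 pq ha yc; have a0 := lp_bound_ge0 ha; have c0 := lp_bound_ge0 yc.
have : (lp_norm 1 (fun k => h k * y k)%R <= (a * c)%:E)%E.
  apply: (@le_trans _ _ (lp_norm q h * lp_norm p y)%E).
    by apply: (@hoelder _ _ _ counting h y) => //; rewrite addrC.
  by rewrite EFinM lee_pmul// lp_norm_ge0.
move/(lp_norm1P _ (mulr_ge0 a0 c0))/(_ K); apply: le_trans.
exact: ler_norm_sum.
Qed.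

(* Test against [y k = sgn (h k) * |h k| `^ (q - 1)], the equality case of
   Hoelder's inequality. *)
Lemma lp_norm_dual (R : realType) (p q : R) (h : R^nat) (C : R) :
  0 < p -> 0 < q -> p^-1 + q^-1 = 1 -> 0 <= C ->
  (forall K y c, (lp_norm p y <= c%:E)%E ->
    `|\sum_(k < K) h k * y k| <= C * c) ->
  (lp_norm q h <= C%:E)%E.
Proof.
move=> p0 q0 pq C0 hC; apply/(lp_normP _ q0 C0) => K.
have q1 : 1 < q.
  by rewrite -invf_lt1// -pq ltrDr invr_gt0.
have pq1 : (q - 1) * p = q.
  have -> : q - 1 = q * p^-1 by rewrite -[p^-1](addrK q^-1) pq mulrBr mulr1 mulfV ?gt_eqF.
  by rewrite mulfVK ?gt_eqF.
set S := \sum_(k < K) _.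
have S0 : 0 <= S by apply: sumr_ge0 => k _; exact: powR_ge0.
pose y : R^nat := fun k => Num.sg (h k) * `|h k| `^ (q - 1).
have absy k : `|y k| `^ p = `|h k| `^ q.
  rewrite /y; have [->|hk] := eqVneq (h k) 0.
    by rewrite sgr0 mul0r normr0 !powR0 ?gt_eqF.
  by rewrite normrM normr_sg hk mul1r ger0_norm ?powR_ge0// -powRrM pq1.
have yS : (lp_norm p (truncate K y) <= (S `^ p^-1)%:E)%E.
  apply/(lp_normP _ p0 (powR_ge0 _ _)) => M.
  rewrite -powRrM mulVf ?gt_eqF// powRr1//.
  apply: (@le_trans _ _ (\sum_(k < maxn K M | (k < K)%N) `|h k| `^ q)).
    rewrite (big_ord_widen_cond (maxn K M) xpredT
      (fun k => `|truncate K y k| `^ p)) ?leq_maxr//.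
    rewrite big_mkcond [leRHS]big_mkcond ler_sum//= => k _.
    rewrite /truncate; case: ifP => _; case: ifP => _ //; rewrite ?absy ?powR_ge0//.
    by rewrite normr0 powR0 ?gt_eqF.
  by rewrite -(big_ord_widen_cond _ xpredT (fun k => `|h k| `^ q)) ?leq_maxl.
have hy : \sum_(k < K) h k * truncate K y k = S.
  apply: eq_bigr => k _; rewrite /truncate ltn_ord /y mulrA [h k * _]mulrC -normrEsg.
  by rewrite mulr_powRB1.
(* This reads S <= C * S^(1/p); for S > 0, division by S^(1/p) leaves S^(1/q) <= C. *)
have := hC K _ _ yS; rewrite hy ger0_norm// => SC.
have [S00|Sn0] := eqVneq S 0; first by rewrite S00 powR_ge0.
have Sgt0 : 0 < S by rewrite lt_def Sn0.
have Sq : S `^ q^-1 <= C.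
  have -> : q^-1 = 1 - p^-1 by rewrite -pq addrAC subrr add0r.
  rewrite powRB ?Sn0 ?implybT// powRr1// ler_pdivrMr//.
  exact: powR_gt0.
have -> : S = (S `^ q^-1) `^ q by rewrite -powRrM mulVf ?gt_eqF// powRr1.
by apply: ge0_ler_powR; rewrite ?nnegrE ?powR_ge0// ltW.
Qed.

Definition unit_seq (R : realType) (K : nat) : R^nat := fun i => (i == K)%:R.

Lemma lp_norm_unit (R : realType) (p : R) (K : nat) : 0 < p ->
  (lp_norm p (unit_seq R K) <= 1%:E)%E.
Proof.
move=> p0; apply/(lp_normP _ p0 ler01) => M.
rewrite powR1 (eq_bigr (fun k : 'I_M => if k == K :> nat then 1 else 0)).
  by rewrite -big_mkcond (big_ord1_eq _ (fun=> 1)); case: ifP.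
move=> k _; rewrite /unit_seq; case: eqP => _; first by rewrite normr1 powR1.
by rewrite normr0 powR0 ?gt_eqF.
Qed.

Lemma truncateS (R : realType) (K : nat) (y : R^nat) :
  truncate K.+1 y = (fun k => truncate K y k + y K * unit_seq R K k).
Proof.
apply/funext => k; rewrite /truncate /unit_seq ltnS leq_eqVlt.
have [->|kK] := eqVneq k K; first by rewrite ltnn add0r mulr1.
by rewrite mulr0 addr0.
Qed.

Lemma ell_truncate (R : realType) (p : R) (K : nat) (y : R^nat) : 1 <= p ->
  carrier (ell p) (truncate K y).
Proof.
move=> p1; have p0 : 0 < p by exact: lt_le_trans p1.
elim: K => [|K /lp_finP[c yc]]; apply/lp_finP.
  by exists 0; exact: lp_norm0.
rewrite truncateS; eexists; apply: lp_norm_add_scale p1 yc _.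
exact: lp_norm_unit.
Qed.

Lemma lp_norm1_fset_sum (R : realType) (u : R^nat) (c : R) (N : {fset nat}) :
  (lp_norm 1 u <= c%:E)%E -> \sum_(n <- N) `|u n| <= c.
Proof.
move=> uc; have c0 := lp_bound_ge0 uc.
(* All of [N] lies below [K], so up to order it is a filtered initial segment and its sum is part of
   a partial sum. *)
pose K := (\max_(n <- N) n).+1.
have NK : perm_eq N [seq n <- iota 0 K | n \in N].
  apply: uniq_perm; rewrite ?fset_uniq ?filter_uniq ?iota_uniq// => n.
  rewrite mem_filter mem_iota add0n leq0n /= andbC.
  have [nN|] := boolP (n \in N); last by rewrite andbF.
  rewrite andbT ltnS; apply/esym.
  exact: (@leq_bigmax_seq _ _ xpredT id).
rewrite (perm_big _ NK) big_filter.
apply: le_trans ((lp_norm1P _ c0).1 uc K).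
rewrite -(big_mkord xpredT (fun n => `|u n|)) /index_iota subn0.
by rewrite [leRHS](bigID (mem N))/= lerDl sumr_ge0.
Qed.

(** * The row functionals and their dual norms *)

Section matrix_functionals.
Context {R : realType} (p : R) (A : nat -> nat -> R).
Hypothesis (hp : 1 <= p) (hA : matrix_class (ell_fib p) (ell 1) A).

Let p_gt0 : 0 < p. Proof. exact: lt_le_trans hp. Qed.

Definition row_functional (n : nat) (y : R^nat) : R :=
  matrix_op A (fib_inv y) n.

Definition rows_functional (N : seq nat) (y : R^nat) : R :=
  \sum_(n <- N) row_functional n y.

Let row_partial n m y := series (fun k => A n k * fib_inv y k) m.

Lemma ell_fib_inv y : carrier (ell p) y -> carrier (ell_fib p) (fib_inv y).
Proof. by move=> yp; rewrite /ell_fib/= fib_invK. Qed.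

Lemma row_partial_cvg n y : carrier (ell p) y ->
  row_partial n m y @[m --> \oo] --> row_functional n y.
Proof. by move=> /ell_fib_inv/hA[/(_ n)]. Qed.

Lemma fib_inv_linear j : lp_linear p (fun y => fib_inv y j).
Proof. by apply: lp_linear_sum => k t y z. Qed.

Lemma fib_inv_bounded j : exists C, lp_bounded_by p (fun y => fib_inv y j) C.
Proof.
apply: lp_bounded_sum => k; exists 1 => y c yc.
by rewrite mul1r; exact: lp_norm_coord yc.
Qed.

Lemma row_partial_linear n m : lp_linear p (row_partial n m).
Proof. by apply: lp_linear_sum => k; exact: fib_inv_linear. Qed.

Lemma row_partial_bounded n m : exists C, lp_bounded_by p (row_partial n m) C.
Proof. by apply: lp_bounded_sum => k; exact: fib_inv_bounded. Qed.

Lemma row_linear n : lp_linear p (row_functional n).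
Proof.
move=> t y z yp zp.
have yzp : carrier (ell p) (fun k => y k + t * z k).
  move: yp zp => /lp_finP[a ya] /lp_finP[b zb].
  by apply/lp_finP; eexists; exact: lp_norm_add_scale ya zb.
have := row_partial_cvg (n := n) yzp.
under eq_fun do rewrite row_partial_linear//.
move=> /(cvg_lim (@Rhausdorff R)) <-; apply: cvg_lim => //.
apply: cvgD; first exact: row_partial_cvg.
by apply: cvgM; [exact: cvg_cst|exact: row_partial_cvg].
Qed.

(** The partial sums of the row converge at each [y], hence are pointwise bounded; their uniform
    bound passes to the limit. *)
Lemma row_bounded n : exists C, lp_bounded_by p (row_functional n) C.
Proof.
have [||y yp|C C0 bC] := lp_uniform_boundedness hp (T := row_partial n).
- exact: row_partial_linear.
- exact: row_partial_bounded.
- have /cvgP/cvg_seq_bounded := row_partial_cvg (n := n) yp.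
  move=> [M [_ /(_ (M + 1))]]; rewrite ltrDl ltr01 => /(_ isT) h.
  by exists (M + 1) => m; exact: h.
exists C => y c yc; have yp : carrier (ell p) y by apply/lp_finP; exists c.
have h : `|row_partial n m y| @[m --> \oo] --> `|row_functional n y|.
  by apply: cvg_norm; exact: row_partial_cvg.
rewrite -(cvg_lim (@Rhausdorff R) h); apply: limr_le.
  by apply/cvg_ex; eexists; exact: h.
by apply: nearW => m; exact: bC.
Qed.

Lemma row_unit n k : row_functional n (unit_seq R k) = fib_assoc A n k.
Proof.
rewrite /row_functional /matrix_op /fib_assoc; congr (limn _).
apply/funext => m; rewrite /series/= (big_nat_widenl k 0)//=.
rewrite [RHS]big_mkcond/=; apply: eq_bigr => j _.
by rewrite fib_inv_unit; case: ifP => _; rewrite ?mulr0// mulrC.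
Qed.

Lemma row_truncate n K y :
  row_functional n (truncate K y) = \sum_(k < K) fib_assoc A n k * y k.
Proof.
elim: K => [|K IH]; first by rewrite big_ord0 (lp_linear0 hp (row_linear n)).
rewrite truncateS big_ord_recr/= -IH row_linear; first by rewrite row_unit mulrC.
  exact: ell_truncate.
by apply/lp_finP; exists 1; exact: lp_norm_unit.
Qed.

Lemma rows_linear N : lp_linear p (rows_functional N).
Proof.
have := lp_linear_sum N (fun=> 1) row_linear.
by under eq_fun do under eq_bigr do rewrite mul1r.
Qed.

Lemma rows_bounded N : exists C, lp_bounded_by p (rows_functional N) C.
Proof.
have [C bC] := lp_bounded_sum N (fun=> 1) row_bounded.
by exists C => y c /bC; under eq_bigr do rewrite mul1r.
Qed.

Lemma rows_truncate N K y : rows_functional N (truncate K y) =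
  \sum_(k < K) (\sum_(n <- N) fib_assoc A n k) * y k.
Proof.
rewrite /rows_functional; under eq_bigr do rewrite row_truncate.
by rewrite exchange_big/=; apply: eq_bigr => k _; rewrite mulr_suml.
Qed.

(** At a fixed [y] the l_1 norm of the image under [A] dominates the sums over all finite [N] at
    once, so the family is pointwise bounded. *)
Lemma rows_uniformly_bounded :
  exists2 C, 0 <= C & forall N : {fset nat}, lp_bounded_by p (rows_functional N) C.
Proof.
apply: (lp_uniform_boundedness hp (T := fun N : {fset nat} => rows_functional N)).
- by move=> N; exact: rows_linear.
- by move=> N; exact: rows_bounded.
move=> y /ell_fib_inv/hA[_ /lp_finP[M hM]]; exists M => N.
apply: le_trans (lp_norm1_fset_sum N hM).
exact: ler_norm_sum.
Qed.

(** On truncations the functional is a finite pairing with the column sums of A-bar: Hoelder's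
    inequality bounds it there, and density with continuity extends the bound to l_p. The converse
    is [lp_norm_dual]. *)
Lemma rows_normP (q : R) N t : 0 < q -> p^-1 + q^-1 = 1 -> 0 <= t ->
  (lp_norm q (fun k => \sum_(n <- N) fib_assoc A n k)%R <= t%:E)%E <->
  lp_bounded_by p (rows_functional N) t.
Proof.
move=> q0 pq t0; split=> [ht y c yc|bt]; last first.
  apply: (@lp_norm_dual _ p) => // K y c yc.
  by rewrite -rows_truncate bt// lp_norm_truncate.
have yp : carrier (ell p) y by apply/lp_finP; exists c.
have [C bC] := rows_bounded N.
(* The bound is made positive so that a truncation error of e / C1 can be asked for. *)
have [C1 C1_gt0 bC1] : exists2 C1, 0 < C1 & lp_bounded_by p (rows_functional N) C1.
  exists (`|C| + 1) => [|z d zd]; first by rewrite ltr_wpDl.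
  rewrite (le_trans (bC _ _ zd))// ler_wpM2r ?(lp_bound_ge0 zd)//.
  by rewrite (le_trans (ler_norm _))// lerDl.
apply/ler_addgt0Pr => e e0; have eC : 0 < e / C1 by rewrite divr_gt0.
have [K yK] := truncate_dense p_gt0 yp eC.
have -> : rows_functional N y = rows_functional N (truncate K y) +
    rows_functional N (fun k => y k - truncate K y k).
  have -> : (fun k => y k - truncate K y k) =
      (fun k => y k + (-1) * truncate K y k) by apply/funext => k; rewrite mulN1r.
  by rewrite rows_linear//; [ring|exact: ell_truncate].
rewrite (le_trans (ler_normD _ _))// lerD//.
  by rewrite rows_truncate; exact: (hoelder_sum K p_gt0 q0 pq ht yc).
by rewrite (le_trans (bC1 _ _ yK))// mulrC divfK// gt_eqF.
Qed.

Lemma tail_normP (q : R) m t : 0 < q -> p^-1 + q^-1 = 1 -> 0 <= t ->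
  (tail_norm q A m <= t%:E)%E <->
  forall N : {fset nat}, (forall n, n \in N -> (m < n)%N) ->
    lp_bounded_by p (rows_functional N) t.
Proof.
move=> q0 pq t0; split=> [ht N Nm|bt].
  (* The supremum leaves out the empty set, whose functional is zero. *)
  have [->|N0] := eqVneq N fset0.
    move=> y c yc; rewrite /rows_functional big_seq_fset0 normr0.
    by rewrite mulr_ge0// (lp_bound_ge0 yc).
  apply/(rows_normP _ q0 pq t0); apply: le_trans ht.
  by apply: ereal_sup_ubound; exists N.
by apply: ge_ereal_sup => _ [N [N0 Nm] <-]; apply/(rows_normP _ q0 pq t0)/bt.
Qed.

End matrix_functionals.

(** * Tail sums and finite covers in l_1 *)

Lemma sum_norm_le_fset_sums (R : realType) (u : R^nat) (m : nat) (a : R) :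
  (forall N : {fset nat}, (forall n, n \in N -> (m < n)%N) ->
    `|\sum_(n <- N) u n| <= a) ->
  forall K, \sum_(i < K) `|u (m.+1 + i)%N| <= 2 * a.
Proof.
move=> ua K; pose s := iota m.+1 K.
have sP (P : pred nat) : `|\sum_(n <- s | P n) u n| <= a.
  have uP : uniq [seq n <- s | P n] by rewrite filter_uniq// iota_uniq.
  rewrite -big_filter -(undup_id uP) -(perm_big _ (seq_fset_perm tt _)).
  apply: ua => n; rewrite seq_fsetE mem_filter mem_iota.
  by case/and3P.
have -> : \sum_(i < K) `|u (m.+1 + i)%N| = \sum_(n <- s) `|u n|.
  rewrite -(big_mkord xpredT (fun i => `|u (m.+1 + i)%N|)) /s.
  by rewrite -{2}[m.+1]addn0 iotaDl big_map /index_iota subn0.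
(* Terms of one sign add up without cancellation to the modulus of a single finite sum; the two
   signs give the factor 2. *)
rewrite (bigID (fun n => 0 <= u n))/=.
have -> : \sum_(n <- s | 0 <= u n) `|u n| = \sum_(n <- s | 0 <= u n) u n.
  by apply: eq_bigr => n; exact: ger0_norm.
have -> : \sum_(n <- s | ~~ (0 <= u n)) `|u n| =
    - \sum_(n <- s | ~~ (0 <= u n)) u n.
  by rewrite -sumrN; apply: eq_bigr => n; rewrite -ltNge => /ltr0_norm.
rewrite mulr2n mulrDl mul1r lerD//; first exact: le_trans (ler_norm _) (sP _).
by rewrite (le_trans (ler_norm _))// normrN sP.
Qed.

Lemma lp_norm1_le_split (R : realType) (u : R^nat) (m : nat) (a b : R) :
  \sum_(i < m) `|u i| <= a -> (forall K, \sum_(i < K) `|u (m + i)%N| <= b) ->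
  (lp_norm 1 u <= (a + b)%:E)%E.
Proof.
move=> ua ub; have ab K : \sum_(i < m + K) `|u i| <= a + b.
  by rewrite big_split_ord lerD.
apply/lp_norm1P; first by rewrite (le_trans _ (ab 0%N))// sumr_ge0.
move=> K; apply: le_trans (ab K).
by rewrite [in leRHS]addnC big_split_ord lerDl sumr_ge0.
Qed.

(** The first [m] coordinates lie in a cube and are rounded to a grid of mesh [h], at a total cost
    of at most m * h < e - b. The centres vanish from [m] on, where the distance is at most b. *)
Lemma ell1_grid_cover (R : realType) (m : nat) (D b e : R) :
  0 <= D -> b < e ->
  exists (n : nat) (c : 'I_n -> R^nat), (forall i, carrier (ell 1) (c i)) /\
  [set z : R^nat | carrier (ell 1) z /\ (forall k, (k < m)%N -> `|z k| <= D) /\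
    forall K, \sum_(i < K) `|z (m + i)%N| <= b] `<=`
  \bigcup_i space_ball (ell 1) (c i) e.
Proof.
move=> D0 be; pose h : R := (e - b) / (m.+1)%:R.
have m0 : 0 < m.+1%:R :> R by [].
have h0 : 0 < h by rewrite divr_gt0// subr_gt0.
(* Shifted by [D], a coordinate lies in [0, 2 D], so its rounded index is at most [G]. *)
pose G := Num.bound (2 * D / h).
pose cen (g : {ffun 'I_m -> 'I_G.+1}) : R^nat :=
  fun k => if insub k is Some i then - D + h * (g i)%:R else 0.
have cenE g (i : 'I_m) : cen g i = - D + h * (g i)%:R.
  by rewrite /cen valK.
have cen0 g k : cen g (m + k)%N = 0.
  by rewrite /cen insubF// ltnNge leq_addr.
have cenP g : carrier (ell 1) (cen g).
  apply/lp_finP; exists (\sum_(i < m) `|cen g i| + 0).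
  by apply: lp_norm1_le_split => // K; rewrite big1// => i _; rewrite cen0 normr0.
exists #|{ffun 'I_m -> 'I_G.+1}|, (fun i => cen (enum_val i)).
split=> [i|z [z1 [zD zb]]]; first exact: cenP.
pose a (i : 'I_m) : R := (z i + D) / h.
have a0 i : 0 <= a i.
  have := zD i (ltn_ord i); rewrite ler_norml => /andP[zi _].
  by rewrite divr_ge0 ?(ltW h0)//; lra.
have aG (i : 'I_m) : (Num.truncn (a i) < G.+1)%N.
  rewrite ltnS -(ler_nat R) (@le_trans _ _ (a i)) ?truncn_le//.
  have aD : a i <= 2 * D / h.
    have := zD i (ltn_ord i); rewrite ler_norml => /andP[_ zi].
    by rewrite ler_pM2r ?invr_gt0//; lra.
  have := archi_boundP (le_trans (a0 i) aD); rewrite -/G; lra.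
pose g : {ffun 'I_m -> 'I_G.+1} := [ffun i => Ordinal (aG i)].
exists (enum_rank g) => //; split; first exact: z1.
rewrite enum_rankK -[(z - _)%R]/(fun k => z k - cen g k) /=.
have grid (i : 'I_m) : `|z i - cen g i| <= h.
  rewrite cenE ffunE/=.
  have /andP[] := truncn_itv (a0 i); rewrite -natr1.
  set j := (Num.truncn _)%:R.
  have -> : z i - (- D + h * j) = h * (a i - j).
    by rewrite /a; field; rewrite gt_eqF.
  move=> ja aj; rewrite normrM (gtr0_norm h0) ger0_norm ?subr_ge0//.
  by rewrite ler_piMr ?ltW//; lra.
apply: (@le_lt_trans _ _ (\sum_(i < m) h + b)%:E).
  apply: lp_norm1_le_split; first by apply: ler_sum => i _; exact: grid.
  by move=> K; under eq_bigr do rewrite cen0 subr0.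
rewrite lte_fin sumr_const card_ord -mulr_natl -ltrBrDr /h mulrCA.
by rewrite gtr_pMr ?subr_gt0// ltr_pdivrMr// mul1r ltr_nat.
Qed.

(** * Covers of images versus tail norms *)

Section noncompactness.
Context {R : realType} (p q : R) (A : nat -> nat -> R).
Hypothesis (hp : 1 < p) (q0 : 0 < q) (hpq : p^-1 + q^-1 = 1).
Hypothesis hA : matrix_class (ell_fib p) (ell 1) A.

Let hp1 : 1 <= p. Proof. exact: ltW. Qed.
Let p_gt0 : 0 < p. Proof. exact: lt_le_trans hp1. Qed.

(** Sums of rows over finite sets beyond [m] are at most t * B, so sign splitting bounds the tail by
    2 * t * B. The m + 1 coordinates from 0 to m are bounded by C * B and left to the grid. *)
Lemma matrix_op_cover (m : nat) (t B e : R) : 0 <= t -> 0 <= B ->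
  (tail_norm q A m <= t%:E)%E -> 2 * t * B < e ->
  exists (n : nat) (c : 'I_n -> R^nat), (forall i, carrier (ell 1) (c i)) /\
  matrix_op A @` [set x | carrier (ell_fib p) x /\
    (norm (ell_fib p) x <= B%:E)%E] `<=`
  \bigcup_i space_ball (ell 1) (c i) e.
Proof.
move=> t0 B0 At tBe; have [C C0 bC] := rows_uniformly_bounded hp1 hA.
have [n [c [c1 cov]]] := ell1_grid_cover m.+1 (mulr_ge0 C0 B0) tBe.
exists n, c; split=> // z [x [xp xB] <-]; apply: cov.
have xE : matrix_op A x = row_functional A ^~ (fibF x).
  by apply/funext => k; rewrite /row_functional fibFK.
split; first by have [] := hA xp.
rewrite xE; split=> [k _|].
  have := bC [fset k]%fset _ _ xB.
  by rewrite /rows_functional big_seq_fset1.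
move=> K; rewrite -mulrA; apply: sum_norm_le_fset_sums => N Nm.
exact: ((tail_normP hp1 hA m q0 hpq t0).1 At N Nm).
Qed.

(** By homogeneity: [y] is scaled to norm one and carried to the sphere by [fib_inv]; if its norm is
    zero, continuity already makes the value zero. *)
Lemma rows_bounded_sphere (N : seq nat) (t : R) : 0 <= t ->
  (forall x, space_sphere (ell_fib p) x ->
    `|\sum_(n <- N) matrix_op A x n| <= t) ->
  lp_bounded_by p (rows_functional A N) t.
Proof.
move=> t0 St y c yc; have yp : carrier (ell p) y by apply/lp_finP; exists c.
pose s := fine (lp_norm p y).
have sE : lp_norm p y = s%:E.
  by rewrite /s fineK// ge0_fin_numE ?lp_norm_ge0//.
have sc : s <= c by rewrite -lee_fin -sE.
have ys : (lp_norm p y <= s%:E)%E by rewrite sE.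
have := lp_bound_ge0 ys; rewrite le_eqVlt => /predU1P[s0|s0].
  have [C bC] := rows_bounded hp1 hA N.
  have := bC _ _ ys; rewrite -s0 mulr0 => /le_trans; apply.
  by rewrite mulr_ge0// (lp_bound_ge0 yc).
pose w : R^nat := fun k => s^-1 * y k.
have yE : y = (fun k => s * w k).
  by apply/funext => k; rewrite /w mulrA mulfV ?mul1r// gt_eqF.
have w1 : (lp_norm p w <= 1%:E)%E.
  have := lp_normZ s^-1 p_gt0 ys.
  by rewrite gtr0_norm ?invr_gt0// mulVf// gt_eqF.
have wp : carrier (ell p) w by apply/lp_finP; exists 1.
(* [lp_normZ] only bounds from above; the lower bound comes from scaling [w] back to [y]. *)
have wE : lp_norm p w = 1%:E.
  apply/eqP; rewrite eq_le w1/=.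
  have wf : lp_norm p w = (fine (lp_norm p w))%:E.
    by rewrite fineK// ge0_fin_numE ?lp_norm_ge0.
  have := lp_normZ s p_gt0 (_ : (lp_norm p w <= (fine (lp_norm p w))%:E)%E).
  rewrite -wf lexx -yE sE lee_fin gtr0_norm// => /(_ isT).
  by rewrite wf lee_fin -ler_pdivrMl// mulVf// gt_eqF.
have wS : space_sphere (ell_fib p) (fib_inv w).
  by split; rewrite /= fib_invK ?wE// ltry.
rewrite yE (lp_linearZ hp1 s (rows_linear hp1 hA N) wp) normrM gtr0_norm// mulrC.
by apply: ler_pM => //; [exact: ltW|exact: St].
Qed.

(** Finitely many centres have l_1 tails at most [d] beyond a common [m]. There a sum of image
    entries is within [e] of the same sum for the centre of a covering ball. *)
Lemma tail_norm_le_cover (n : nat) (c : 'I_n -> R^nat) (r : 'I_n -> R) (e d : R) :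
  (forall i, carrier (ell 1) (c i)) -> (forall i, r i <= e) ->
  matrix_op A @` space_sphere (ell_fib p) `<=`
    \bigcup_i space_ball (ell 1) (c i) (r i) ->
  0 <= e -> 0 < d -> exists m, (tail_norm q A m <= (e + d)%:E)%E.
Proof.
move=> c1 re cov e0 d0.
have /choice[M cM] i := truncate_dense ltr01 (c1 i) d0.
exists (\max_(i < n) M i); apply/(tail_normP hp1 hA _ q0 hpq).
  by rewrite addr_ge0// ltW.
move=> N Nm; apply: rows_bounded_sphere => [|x xS].
  by rewrite addr_ge0// ltW.
have [|i _ [_ zi]] := cov (matrix_op A x); first by exists x.
rewrite /= in zi.
set z := matrix_op A x in zi *.
have zN : \sum_(n <- N) `|z n - c i n| <= e.
  apply: lp_norm1_fset_sum; apply: le_trans (ltW zi) _.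
  by rewrite lee_fin.
have cN : \sum_(n <- N) `|c i n| <= d.
  have := lp_norm1_fset_sum N (cM i); apply: le_trans.
  rewrite le_eqVlt; apply/orP; left; apply/eqP.
  rewrite big_seq [RHS]big_seq; apply: eq_bigr => k /Nm kM.
  rewrite /truncate ltnNge (leq_trans _ (ltnW kM)) ?subr0//.
  exact: (leq_bigmax i).
have -> : \sum_(n <- N) z n = \sum_(n <- N) (z n - c i n) + \sum_(n <- N) c i n.
  by rewrite -big_split/=; apply: eq_bigr => k _; rewrite subrK.
by rewrite (le_trans (ler_normD _ _))// lerD// (le_trans (ler_norm_sum _ _ _)).
Qed.

(** The families of index sets shrink with [m], so the tail norms decrease to their infimum, which
    the uniform bound on row sums makes finite. *)
Lemma tail_norm_cvg : exists l : R, [/\ 0 <= l,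
  tail_norm q A m @[m --> \oo] --> l%:E,
  (forall m, (l%:E <= tail_norm q A m)%E) &
  forall e, 0 < e -> exists m, (tail_norm q A m <= (l + e)%:E)%E].
Proof.
have noninc : {homo tail_norm q A : m n / (m <= n)%N >-> (n <= m)%E}.
  move=> m n mn; apply: ereal_sup_le => _ [N [N0 Nn] <-].
  by exists N => //; split=> // k /Nn; exact: leq_ltn_trans.
have := ereal_nonincreasing_cvgn noninc.
set L := ereal_inf _ => cvL.
have [C C0 bC] := rows_uniformly_bounded hp1 hA.
have L0 : (0 <= L)%E.
  (* The singleton of m + 1 shows that the supremum is taken over a nonempty family, hence is
     nonnegative. *)
  apply: le_ereal_inf_tmp => _ [m _ <-]; apply: le_trans (lp_norm_ge0 q
    (fun k => \sum_(n <- [fset m.+1]%fset) fib_assoc A n k)) _.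
  apply: ereal_sup_ubound; exists [fset m.+1]%fset => //; split.
    by apply/fset0Pn; exists m.+1; rewrite inE.
  by move=> n; rewrite inE => /eqP ->.
have LC : (L <= C%:E)%E.
  apply: (@le_trans _ _ (tail_norm q A 0)).
    by apply: ereal_inf_lbound; exists 0%N.
  by apply/(tail_normP hp1 hA _ q0 hpq C0) => N _.
have LE : L = (fine L)%:E.
  by rewrite fineK// ge0_fin_numE// (le_lt_trans LC)// ltry.
exists (fine L); split.
- exact: fine_ge0.
- by rewrite -LE.
- by move=> m; rewrite -LE; apply: ereal_inf_lbound; exists m.
- move=> e e0; have : L \is a fin_num by rewrite LE.
  move=> /(lb_ereal_inf_adherent e0)[_ [m _ <-] h].
  by exists m; rewrite EFinD -LE ltW.
Qed.

End noncompactness.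

(** * The two estimates and the compactness criterion *)

Unset Implicit Arguments.

Theorem theorem3p7 (R : realType) (p q : R) (A : nat -> nat -> R)
    (hp : 1 < p) (hq : q = p / (p - 1))
    (hA : matrix_class (ell_fib p) (ell 1) A) :
  exists l : R,
    [/\ tail_norm q A m @[m --> \oo] --> l%:E,
        (l%:E <= operator_mnc (ell_fib p) (ell 1) (matrix_op A))%E,
        (operator_mnc (ell_fib p) (ell 1) (matrix_op A) <= 4%:E * l%:E)%E
      & compact_operator (ell_fib p) (ell 1) (matrix_op A) <-> l = 0].
Proof.
have p0 : 0 < p by lra.
have q0 : 0 < q by rewrite hq divr_gt0// subr_gt0.
have hpq : p^-1 + q^-1 = 1.
  by rewrite hq; field; rewrite !gt_eqF// subr_gt0.
have [l [l0 cvl lle lge]] := tail_norm_cvg hp q0 hpq hA.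
exists l; split => //.
- apply: le_ereal_inf_tmp => _ [e [e0 [n [c [r [c1 re cov]]]]] <-].
  rewrite lee_fin; apply/ler_addgt0Pr => d d0.
  have [m hm] := tail_norm_le_cover hp q0 hpq hA c1 (fun i => ltW (re i)) cov (ltW e0) d0.
  by rewrite -lee_fin (le_trans (lle m)).
- rewrite -EFinM; apply/lee_addgt0Pr => d d0; rewrite -EFinD.
  (* With t = l + d/8 one has 2 t < 2 l + d/2 < 4 l + d; the slack keeps both inequalities strict
     even for l = 0. *)
  have d8 : 0 < d / 8 by rewrite divr_gt0.
  have [m hm] := lge _ d8.
  have t0 : 0 <= l + d / 8 by lra.
  have tBe : 2 * (l + d / 8) * 1 < 2 * l + d / 2 by lra.
  have [n [c [c1 cov]]] := matrix_op_cover hp q0 hpq hA t0 ler01 hm tBe.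
  apply: ereal_inf_lbound; exists (4 * l + d) => //; split; first by lra.
  exists n, c, (fun=> 2 * l + d / 2); split=> // [i|]; first by lra.
  apply: subset_trans cov; apply: image_subset => x [xp x1].
  by split=> //; rewrite x1.
split=> [cpt|l00 Q [QX [M QM]] e e0].
  apply/eqP; rewrite eq_le l0 andbT; apply/ler_addgt0Pr => d d0; rewrite add0r.
  (* One half of [d] is spent on the radius of the balls, the other on the tails of their
     centres. *)
  have d2 : 0 < d / 2 by rewrite divr_gt0.
  have [|n [c [c1 cov]]] := cpt (space_sphere (ell_fib p)) _ _ d2.
    by split=> [x []//|]; exists 1 => x [_ ->].
  have [m hm] := tail_norm_le_cover hp q0 hpq hA c1
    (fun=> lexx (d / 2)) cov (ltW d2) d2.
  by rewrite -splitr in hm; rewrite -lee_fin (le_trans (lle m)).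
(* [M] may fail to be positive, hence [B]; [t] is chosen to make 2 * t * B equal to e / 2. *)
pose B := `|M| + 1; have B0 : 0 < B by rewrite ltr_wpDl.
pose t := e / (4 * B); have t0 : 0 < t by rewrite divr_gt0// mulr_gt0.
have [m] := lge _ t0; rewrite l00 add0r => hm.
have tBe : 2 * t * B < e.
  have -> : 2 * t * B = e / 2 by rewrite /t; field; rewrite gt_eqF.
  lra.
have [n [c [c1 cov]]] := matrix_op_cover hp q0 hpq hA (ltW t0) (ltW B0) hm tBe.
exists n, c; split=> //; apply: subset_trans cov; apply: image_subset => x Qx.
split; first exact: QX.
apply: le_trans (QM x Qx) _.
by rewrite lee_fin (le_trans (ler_norm _))// lerDl.
Qed.
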